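(* Fix $t\in\mathbb{N}$ and let $M$ be the matroid union $M_1\vee M_2\vee\cdots\vee M_k$ with $k\geq 1$ (all $M_i$ on the ground set $E(M)$). For each $i\in[k]$ and $j\in[t]$, let $M_{i,j}$ be the matroid on $S_{E(M)}$ obtained from $M_i$ by, for each $e\in E(M)$, adding each element of $S_e-e$ parallel to $e$ if $r_{M_i}(e)=1$, or as a loop if $r_{M_i}(e)=0$. Then $M^t=\bigvee_{i\in[k],\,j\in[t]}M_{i,j}$.
   Context: A cyclic flat of a matroid $M$ is a flat $F$ such that $M|F$ has no coloops; $\mathcal{Z}(M)$ denotes the set of cyclic flats, and a matroid is determined by its cyclic flats and their ranks. The $t$-expansion: fix $t\in\mathbb{N}$; for each $e\in E(M)$ let $S_e$ be a $t$-element set with $e\in S_e$, the sets $S_e$ pairwise disjoint; for $X\subseteq E(M)$ let $S_X=\bigcup_{e\in X}S_e$. The $t$-expansion $M^t$ is the matroid on $S_{E(M)}$ whose cyclic flats are exactly the sets $S_A$ with $A\in\mathcal{Z}(M)$, with $r_{M^t}(S_A)=t\cdot r_M(A)$. The matroid union $N_1\vee\cdots\vee N_m$ of matroids on a common set $E$ is the matroid on $E$ whose independent sets are the sets $I_1\cup\cdots\cup I_m$ with $I_j$ independent in $N_j$. $[k]=\{1,\dots,k\}$. *)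

(* Defs.v *)
From HB Require Import structures.
From mathcomp Require Import all_boot.

Set Implicit Arguments.
Unset Strict Implicit.
Unset Printing Implicit Defensive.

Section MatroidAxioms.
Variable U : finType.
Implicit Types (E : {set U}) (F : {set {set U}}).

Definition indep_hereditary F :=
  [forall I in F, forall J : {set U}, (J \subset I) ==> (J \in F)].

Definition indep_augmentation F :=
  [forall I in F, forall J in F,
     (#|I| < #|J|) ==> [exists e in J :\: I, e |: I \in F]].

Definition matroid_axioms E F :=
  [&& set0 \in F, [forall I in F, I \subset E],
      indep_hereditary F & indep_augmentation F].

(* A matroid whose ground set is a subset of a finite ambient type [U].  The
   axioms are boolean, so [=] on [matroid U] is equality of the ground sets
   and of the independent sets. *)
Record matroid := Matroid {
  ground : {set U};
  indep : {set {set U}};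
  matroidP : matroid_axioms ground indep }.

End MatroidAxioms.

Section Basics.
Variable U : finType.
Implicit Types (M N : matroid U) (I J X Y F : {set U}) (e f : U).

Lemma matroid_eq M N : ground M = ground N -> indep M = indep N -> M = N.
Proof.
case: M N => [E1 F1 a1] [E2 F2 a2] /= eE eF.
by case: E2 / eE a2; case: F2 / eF => a2; rewrite (bool_irrelevance a1 a2).
Qed.

Lemma matroid_axiomsP (E : {set U}) (A : {set {set U}}) :
  set0 \in A ->
  (forall I, I \in A -> I \subset E) ->
  (forall I J, I \in A -> J \subset I -> J \in A) ->
  (forall I J, I \in A -> J \in A -> #|I| < #|J| ->
     exists2 e, e \in J :\: I & e |: I \in A) ->
  matroid_axioms E A.
Proof.
move=> h0 hs hh ha; apply/and4P; split=> //.
- by apply/forall_inP.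
- by apply/forall_inP => I IA; apply/forallP => J; apply/implyP; apply: hh.
- apply/forall_inP => I IA; apply/forall_inP => J JA; apply/implyP => lt.
  by have [e eJ eI] := ha _ _ IA JA lt; apply/exists_inP; exists e.
Qed.

Lemma indep0 M : set0 \in indep M.
Proof. by case/and4P: (matroidP M). Qed.

Lemma indep_sub_ground M I : I \in indep M -> I \subset ground M.
Proof. by case/and4P: (matroidP M) => _ /forall_inP h _ _ /h. Qed.

Lemma indepS M I J : I \in indep M -> J \subset I -> J \in indep M.
Proof.
case/and4P: (matroidP M) => _ _ /forall_inP h _ /h /forallP /(_ J).
by move/implyP.
Qed.

Lemma indep_aug M I J : I \in indep M -> J \in indep M -> #|I| < #|J| ->
  exists2 e, e \in J :\: I & e |: I \in indep M.
Proof.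
case/and4P: (matroidP M) => _ _ _ /forall_inP h /h /forall_inP h' /h' /implyP.
by move=> {}h /h /exists_inP.
Qed.

Definition rank M X : nat := \max_(I in indep M | I \subset X) #|I|.

Definition dependent M X : bool := (X \subset ground M) && (X \notin indep M).

Definition circuit M X : bool := minset (dependent M) X.

Definition basis M X : bool := maxset (mem (indep M)) X.

Definition loop M e : bool := circuit M [set e].

Definition parallel M e f : bool := (e != f) && circuit M [set e; f].

Definition coloop M e : Prop :=
  e \in ground M /\ forall B, basis M B -> e \in B.

Definition flat M F : Prop :=
  F \subset ground M /\
  forall e, e \in ground M :\: F -> rank M F < rank M (e |: F).

Fact restr_axioms M X :
  matroid_axioms (ground M :&: X) [set I in indep M | I \subset X].
Proof.
apply: matroid_axiomsP.
- by rewrite inE indep0 sub0set.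
- by move=> I; rewrite inE subsetI => /andP[/indep_sub_ground -> ->].
- move=> I J; rewrite !inE => /andP[hI IX] JI.
  by rewrite (indepS hI JI) (subset_trans JI IX).
- move=> I J; rewrite !inE => /andP[hI IX] /andP[hJ JX] lt.
  have [e eJ eI] := indep_aug hI hJ lt; exists e => //.
  rewrite inE eI subUset IX sub1set (subsetP JX) //.
  by move: eJ; rewrite inE => /andP[].
Qed.

Definition restr M X : matroid U := Matroid (restr_axioms M X).

Definition cyclic_flat M F : Prop :=
  flat M F /\ forall e, ~ coloop (restr M F) e.

End Basics.

Section Union.
Variables (U T : finType) (N : T -> matroid U).

Definition union_ground : {set U} := \bigcup_i ground (N i).

Definition union_indep : {set {set U}} :=
  [set I | [exists J : {ffun T -> {set U}},
     [forall i, J i \in indep (N i)] && (I == \bigcup_i J i)]].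

Lemma union_indepP (I : {set U}) :
  reflect (exists2 J : {ffun T -> {set U}},
             forall i, J i \in indep (N i) & I = \bigcup_i J i)
          (I \in union_indep).
Proof.
rewrite inE; apply: (iffP existsP) => [[J /andP[/forallP hJ /eqP ->]]|[J hJ ->]].
  by exists J.
by exists J; rewrite eqxx andbT; apply/forallP.
Qed.

(* Independent sets of the union, as maps assigning a part to each element. *)
Let good (X : {set U}) (c : {ffun U -> option T}) :=
  (X == [set x | c x != None :> option T]) &&
  [forall i, [set x | c x == Some i] \in indep (N i)].

Let goodP X : reflect (exists c, good X c) (X \in union_indep).
Proof.
apply: (iffP (union_indepP X)) => [[J hJ ->]|[c /andP[/eqP -> /forallP hc]]].
  exists [ffun x => [pick i | x \in J i]]; apply/andP; split.
    apply/eqP/setP => x; rewrite inE ffunE.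
    case: pickP => [i xi|no]; first by apply/bigcupP; exists i.
    by apply/bigcupP => -[i _]; rewrite no.
  apply/forallP => i; apply: indepS (hJ i) _; apply/subsetP => x.
  by rewrite inE ffunE; case: pickP => // j xj /eqP [<-].
exists [ffun i => [set x | c x == Some i]] => [i|]; first by rewrite ffunE.
apply/setP => x; rewrite inE; apply/idP/bigcupP.
  by case E: (c x) => [i|] // _; exists i => //; rewrite ffunE inE E.
by case=> i _; rewrite ffunE inE => /eqP ->.
Qed.

Let card_good X c : good X c -> #|X| = \sum_i #|[set x | c x == Some i]|.
Proof.
case/andP => /eqP -> _; rewrite -sum1_card.
under [RHS]eq_bigr do rewrite -sum1_card.
under [RHS]eq_bigr => i _ do rewrite big_mkcond /=.
rewrite exchange_big big_mkcond /=; apply: eq_bigr => x _.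
rewrite inE; case E: (c x) => [i|] /=.
  rewrite (bigD1 i) //= inE E eqxx big1 // => j /negbTE ji.
  by rewrite inE E (inj_eq Some_inj) eq_sym ji.
by rewrite big1 // => j _; rewrite inE E.
Qed.

Fact union_axioms : matroid_axioms union_ground union_indep.
Proof.
apply: matroid_axiomsP.
- apply/union_indepP; exists [ffun=> set0] => [i|]; first by rewrite ffunE indep0.
  by rewrite big1 // => i _; rewrite ffunE.
- move=> I /union_indepP[J hJ ->]; apply/bigcupsP => i _.
  exact: subset_trans (indep_sub_ground (hJ i)) (bigcup_sup i _).
- move=> I K /union_indepP[J hJ ->] KI; apply/union_indepP.
  exists [ffun i => J i :&: K] => [i|].
    by rewrite ffunE; apply: indepS (hJ i) (subsetIl _ _).
  under eq_bigr do rewrite ffunE.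
  by rewrite -big_distrl /=; apply/esym/setIidPr.
move=> I J /goodP[c0 gc0] /goodP[d gd] lt.
(* Choose [c] agreeing with [d] on as many elements as possible. *)
pose m (c : {ffun U -> option T}) := #|[set x | (c x == d x) && (c x != None)]|.
case: (@arg_maxnP _ c0 (good I) m gc0) => c gc cmax.
have [i lti] : exists i,
    #|[set x | c x == Some i]| < #|[set x | d x == Some i]|.
  apply/existsP; apply: contraLR lt; rewrite negb_exists => /forallP h.
  rewrite (card_good gc) (card_good gd) -leqNgt; apply: leq_sum => i _.
  by rewrite leqNgt.
case/andP: (gc) => /eqP eI /forallP hc; case/andP: (gd) => /eqP eJ /forallP hd.
have [x] := indep_aug (hc i) (hd i) lti.
rewrite !inE => /andP[cx /eqP dx] hx.
pose c' := [ffun y => if y == x then Some i else c y].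
have gc' : good (x |: I) c'.
  apply/andP; split.
    apply/eqP/setP => y; rewrite eI !inE ffunE.
    by have [->|] := eqVneq y x.
  apply/forallP => j; have [->|ji] := eqVneq j i.
    apply: indepS hx _; apply/subsetP => y; rewrite !inE ffunE.
    by have [->|] := eqVneq y x.
  apply: indepS (hc j) _; apply/subsetP => y; rewrite !inE ffunE.
  have [_ /eqP[eij]|//] := eqVneq y x; by rewrite eij eqxx in ji.
exists x; last by apply/goodP; exists c'.
rewrite eJ !inE dx andbT; apply/negP => xI.
have gI : good I c' by rewrite -(setUidPr (_ : [set x] \subset I)) ?sub1set.
have := cmax _ gI; rewrite /= leqNgt => /negP; apply.
apply: proper_card; apply/properP; split.
  apply/subsetP => y; rewrite !inE ffunE.
  by have [->|//] := eqVneq y x; rewrite dx eqxx.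
exists x; first by rewrite !inE ffunE eqxx dx eqxx.
by rewrite !inE dx (negbTE cx).
Qed.

(* When the [N i] have a common ground set (and [T] is inhabited), this is the
   ground set of the union. *)
Definition matroid_union : matroid U := Matroid union_axioms.

End Union.

Section Expansion.
Variable U : finType.
Implicit Types (M N : matroid U) (X E : {set U}) (S : U -> {set U}) (t : nat).

Definition blow_up S X : {set U} := \bigcup_(e in X) S e.

Definition expansion_sets t E S : Prop :=
  [/\ {in E, forall e, e \in S e},
      {in E, forall e, #|S e| = t} &
      {in E &, forall e f, e != f -> [disjoint S e & S f]}].

(* [N] is the t-expansion of [M].  A matroid is determined by its cyclic flats
   and their ranks, so these conditions hold for at most one [N]. *)
Definition is_expansion t S M N : Prop :=
  [/\ ground N = blow_up S (ground M),
      forall X, cyclic_flat N X <->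
                exists2 A, cyclic_flat M A & X = blow_up S A &
      forall A, cyclic_flat M A -> rank N (blow_up S A) = t * rank M A].

(* [N] is [M] with each element of S_e - e added parallel to e, or as a loop
   when e has rank 0. *)
Definition is_parallel_extension S M N : Prop :=
  [/\ ground N = blow_up S (ground M),
      restr N (ground M) = M,
      forall e f, e \in ground M -> f \in S e :\ e ->
        rank M [set e] = 1 -> parallel N e f &
      forall e f, e \in ground M -> f \in S e :\ e ->
        rank M [set e] = 0 -> loop N f].

Section ParallelExtension.
Variables (t : nat) (M : matroid U) (S : U -> {set U}).
Hypothesis S_sets : expansion_sets t (ground M) S.

Let E := ground M.
Let p (x : U) : U := odflt x [pick e in E | x \in S e].

Let pE e x : e \in E -> x \in S e -> p x = e.
Proof.
case: S_sets => _ _ dis eE xe; rewrite /p.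
case: pickP => [f /andP[fE xf]|/(_ e)]; last by rewrite eE xe.
apply/eqP; apply: contraT => fe.
have := dis _ _ fE eE fe; rewrite disjoints_subset => /subsetP /(_ _ xf).
by rewrite inE xe.
Qed.

Let pid e : e \in E -> p e = e.
Proof. by move=> eE; apply: pE => //; case: S_sets => h _ _; apply: h. Qed.

Let par_indep : {set {set U}} :=
  [set X : {set U} | [&& X \subset blow_up S E, p @: X \in indep M & #|p @: X| == #|X|]].

Let par_axioms : matroid_axioms (blow_up S E) par_indep.
Proof.
apply: matroid_axiomsP.
- by rewrite inE sub0set imset0 indep0 !cards0.
- by move=> I; rewrite inE => /and3P[].
- move=> I J; rewrite !inE => /and3P[IE pI /imset_injP injI] JI.
  rewrite (subset_trans JI IE) (indepS pI (imsetS _ JI)) /=.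
  by apply/imset_injP => x y xJ yJ; apply: injI; apply: (subsetP JI).
move=> I J; rewrite !inE => /and3P[IE pI /eqP cI] /and3P[JE pJ /eqP cJ].
rewrite -{1}cI -{1}cJ => lt; have [e] := indep_aug pI pJ lt.
rewrite inE => /andP[eI /imsetP[x xJ ex]] hx.
have xI : x \notin I by apply: contra eI => xI; rewrite ex imset_f.
exists x; first by rewrite inE xI.
rewrite !inE imsetU1 -ex hx subUset IE sub1set (subsetP JE) //=.
by rewrite !cardsU1 eI xI cI.
Qed.

Lemma parallel_extension_exists : exists N, is_parallel_extension S M N.
Proof.
have [eS _ _] := S_sets.
have ES : E \subset blow_up S E.
  by apply/subsetP => e eE; apply/bigcupP; exists e; rewrite ?eS.
have pX X : X \subset E -> p @: X = X.
  move=> /subsetP XE; rewrite -[RHS]imset_id; apply: eq_in_imset => x /XE.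
  exact: pid.
have pS e f : e \in E -> f \in S e :\ e ->
    [/\ p e = e, p f = e, f \in blow_up S E, e \in blow_up S E & e != f].
  move=> eE; rewrite !inE => /andP[fe fS]; rewrite pid // (pE eE) // eq_sym fe.
  by split=> //; [apply/bigcupP; exists e | exact: (subsetP ES)].
have r1 e : e \in E -> rank M [set e] = ([set e] \in indep M).
  move=> eE; rewrite /rank; case: (boolP (_ \in _)) => h.
    apply/eqP; rewrite eqn_leq; apply/andP; split.
      by apply/bigmax_leqP => I /andP[_ /subset_leq_card]; rewrite cards1.
    by apply: (bigmax_sup [set e]); rewrite ?h ?cards1 /=.
  apply/eqP; rewrite -leqn0; apply/bigmax_leqP => I /andP[hI].
  by rewrite subset1 => /orP[/eqP eI|/eqP ->]; rewrite ?cards0 // -eI hI in h *.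
exists (Matroid par_axioms); split=> //.
- apply: matroid_eq => /=; first exact/setIidPr.
  apply/setP => X; rewrite !inE; apply/andP/idP => [[/and3P[_ h _] XE]|hX].
    by rewrite pX in h.
  have XE := indep_sub_ground hX.
  by rewrite pX // hX eqxx (subset_trans XE ES).
- move=> e f eE fS; rewrite r1 // => /eqP; rewrite eqb1 => he.
  have [pe pf fB eB ef] := pS _ _ eE fS.
  rewrite /parallel ef; apply/minsetP; split.
    rewrite /dependent /= subUset !sub1set eB fB /= !inE imsetU1 imset_set1.
    by rewrite pe pf setUid cards1 cards2 ef !andbF.
  move=> B /andP[_ nB] Bef; apply/eqP; rewrite eqEsubset Bef /=.
  apply: contraR nB => nB; rewrite /= inE.
  have : (B == set0) || [exists x in [set e; f], B == [set x]].
    have [->|[x xB]] := set_0Vmem B; first by rewrite eqxx.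
    apply/orP; right; apply/exists_inP; exists x; first exact: (subsetP Bef).
    have lt : #|B| <= 1.
      rewrite -ltnS; have := proper_card (_ : B \proper [set e; f]).
      by rewrite cards2 ef; apply; rewrite properE Bef.
    by rewrite eq_sym eqEcard sub1set xB cards1.
  case/orP => [/eqP ->|/exists_inP[x xef /eqP ->]].
    by rewrite sub0set imset0 indep0 !cards0.
  rewrite imset_set1 !cards1 eqxx andbT sub1set.
  by move: xef; rewrite !inE => /orP[]/eqP ->; rewrite ?pe ?pf he ?eB ?fB.
- move=> e f eE fS; rewrite r1 // => /eqP; rewrite eqb0 => he.
  have [pe pf fB eB ef] := pS _ _ eE fS.
  apply/minsetP; split.
    by rewrite /dependent /= sub1set fB inE imset_set1 pf (negbTE he) andbF.
  move=> B /andP[_ nB]; rewrite subset1 => /orP[/eqP //|/eqP B0].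
  by rewrite B0 indep0 in nB.
Qed.

End ParallelExtension.

End Expansion.

(* Main.v *)
Require Import Defs.
From HB Require Import structures.
From mathcomp Require Import all_boot zify.

(** Write [f] for the sum of the rank functions of the [M_i].  The matroid union
    theorem gives [r_M(A) = min_B f(B) + |A - B|].  An element of [S_e] has in
    every [M_(i,j)] the same closure as [e], so the union [N] of the [M_(i,j)]
    has [r_N(X) = min_B t f(B) + |X - S_B|]; in particular
    [r_N(S_A) = t r_M(A)].  Comparing the two formulas, a minimiser for a cyclic
    flat [X] of [N] forces [X = S_B], and the cyclic flats of [N] are exactly
    the blow-ups of those of [M].  Uniqueness holds because a set is independent
    iff it meets each cyclic flat in at most rank-many elements: the closure of
    a circuit is a cyclic flat. *)

Set Implicit Arguments.
Unset Strict Implicit.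
Unset Printing Implicit Defensive.

Lemma set_ind (U : finType) (P : {set U} -> Prop) :
  P set0 -> (forall x (A : {set U}), x \notin A -> P A -> P (x |: A)) -> forall A, P A.
Proof.
move=> P0 PU1 A; have [n] := ubnP #|A|.
elim: n A => // n IH A leA; have [->//|[x xA]] := set_0Vmem A.
rewrite -(setD1K xA); apply: PU1; first by rewrite !inE eqxx.
by apply: IH; rewrite (cardsD1 x) xA in leA.
Qed.

(** * Rank, closure and cyclic flats in a single matroid *)

Section Rank.
Variable U : finType.
Implicit Types (M N : matroid U) (I J X Y F : {set U}) (e f : U).

Lemma leq_card_rank M I X : I \in indep M -> I \subset X -> #|I| <= rank M X.
Proof. by move=> hI IX; apply: (bigmax_sup I); rewrite ?hI. Qed.

Lemma rank_witness M X :
  exists I, [/\ I \in indep M, I \subset X & #|I| = rank M X].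
Proof.
have P0 : (set0 \in indep M) && (set0 \subset X) by rewrite indep0 sub0set.
have [I /andP[hI IX] eI] :=
  @eq_bigmax_cond _ [pred I in indep M | I \subset X] (fun I => #|I|)
    (introT card_gt0P (ex_intro _ set0 P0)).
by exists I; split=> //; rewrite -eI.
Qed.

Lemma rank_leq_card M X : rank M X <= #|X|.
Proof. by have [I [_ /subset_leq_card IX <-]] := rank_witness M X. Qed.

Lemma rank_mono M X Y : X \subset Y -> rank M X <= rank M Y.
Proof.
have [I [hI IX <-] XY] := rank_witness M X.
exact: leq_card_rank hI (subset_trans IX XY).
Qed.

Lemma rank_leqif_card M X : rank M X <= #|X| ?= iff (X \in indep M).
Proof.
split; first exact: rank_leq_card.
apply/eqP/idP => [eX|hX]; last first.
  by apply/eqP; rewrite eqn_leq rank_leq_card leq_card_rank.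
have [I [hI IX cI]] := rank_witness M X.
suff <- : I = X by [].
by apply/eqP; rewrite eqEcard IX cI eX leqnn.
Qed.

Lemma rank_indep M I : I \in indep M -> rank M I = #|I|.
Proof. by move=> hI; apply/eqP; rewrite rank_leqif_card. Qed.

Lemma indep_extend M J X : J \in indep M -> J \subset X ->
  exists I, [/\ I \in indep M, J \subset I, I \subset X & #|I| = rank M X].
Proof.
move=> hJ JX; have PJ : [&& J \in indep M, J \subset J & J \subset X].
  by rewrite hJ subxx.
case: (@arg_maxnP _ J [pred I | [&& I \in indep M, J \subset I & I \subset X]]
  (fun I => #|I|) PJ) => I /and3P[hI JI IX] maxI.
exists I; split=> //; apply/eqP; rewrite eqn_leq leq_card_rank //= leqNgt.
apply/negP => lt; have [K [hK KX cK]] := rank_witness M X.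
rewrite -cK in lt; have [e] := indep_aug hI hK lt.
rewrite inE => /andP[eI eK] he.
have : #|e |: I| <= #|I|.
  apply: maxI; rewrite /= he subUset sub1set (subsetP KX) // IX.
  by rewrite (subset_trans JI) ?subsetUr.
by rewrite cardsU1 eI; lia.
Qed.

(** A maximum independent subset [I] of the intersection extends to a maximum one [J] of the union.
    The traces of [J] on [X] and [Y] cover [J] and share at least [I]. *)
Lemma rank_submod M X Y :
  rank M (X :|: Y) + rank M (X :&: Y) <= rank M X + rank M Y.
Proof.
have [I [hI IXY <-]] := rank_witness M (X :&: Y).
have IX := subset_trans IXY (subset_trans (subsetIl X Y) (subsetUl X Y)).
have [J [hJ IJ JXY <-]] := indep_extend hI IX.
have hX : #|J :&: X| <= rank M X.
  by apply: leq_card_rank; [apply: indepS hJ (subsetIl _ _)|apply: subsetIr].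
have hY : #|J :&: Y| <= rank M Y.
  by apply: leq_card_rank; [apply: indepS hJ (subsetIl _ _)|apply: subsetIr].
have hJI : #|I| <= #|J :&: X :&: (J :&: Y)|.
  by rewrite -setIIr; apply: subset_leq_card; rewrite subsetI IJ.
have := cardsUI (J :&: X) (J :&: Y).
by rewrite -setIUr (setIidPl JXY); lia.
Qed.

Lemma rankUl_leq M X Y : rank M (X :|: Y) <= #|X| + rank M Y.
Proof. by have := rank_submod M X Y; have := rank_leq_card M X; lia. Qed.

(** Monotonicity of closure, phrased through rank alone; it is submodularity for [e |: X] and
    [Y]. *)
Lemma rankU1_absorb M e X Y :
  X \subset Y -> rank M (e |: X) = rank M X -> rank M (e |: Y) = rank M Y.
Proof.
move=> XY eX; apply/esym/eqP; rewrite eqn_leq rank_mono ?subsetUr //=.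
have := rank_submod M (e |: X) Y; rewrite -setUA (setUidPr XY) eX.
have : rank M X <= rank M ((e |: X) :&: Y).
  by apply: rank_mono; rewrite subsetI subsetUr.
by lia.
Qed.

Lemma rankU_absorb M X Y :
  {in Y, forall e, rank M (e |: X) = rank M X} -> rank M (Y :|: X) = rank M X.
Proof.
elim/set_ind: Y => [|e Y eY IH] h; first by rewrite set0U.
rewrite -setUA (rankU1_absorb (subsetUr Y X)) ?IH //.
  by move=> f fY; apply: h; rewrite inE fY orbT.
by apply: h; rewrite setU11.
Qed.

Lemma rank_restr M X Y : Y \subset X -> rank (restr M X) Y = rank M Y.
Proof.
move=> YX; apply: eq_bigl => I; rewrite inE -andbA.
by case: (boolP (I \subset Y)) => [IY|]; rewrite ?andbF // (subset_trans IY YX).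
Qed.

Lemma coloop_restrP M F e : F \subset ground M ->
  coloop (restr M F) e <-> e \in F /\ rank M (F :\ e) < rank M F.
Proof.
move=> FE; split=> [[]|[eF lt]].
  rewrite /= (setIidPr FE) => eF allB; split=> //.
  rewrite ltnNge; apply/negP => le.
  have [I [hI IF cI]] := rank_witness M (F :\ e).
  have bI : basis (restr M F) I.
    apply/maxsetP; split=> [|B].
      by rewrite /= inE hI (subset_trans IF) ?subD1set.
    rewrite /= inE => /andP[hB BF] IB; apply/eqP; rewrite eq_sym eqEcard IB /=.
    by rewrite cI (leq_trans _ le) ?leq_card_rank.
  by have := subsetP IF _ (allB _ bI); rewrite !inE eqxx.
split=> [|B /maxsetP[]]; first by rewrite /= (setIidPr FE).
rewrite /= inE => /andP[hB BF] maxB; apply: contraLR lt => eB.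
rewrite -leqNgt; have [I [hI BI IF <-]] := indep_extend hB BF.
have eI : I = B by apply: maxB => //; rewrite inE hI.
by rewrite eI leq_card_rank // subsetD1 BF.
Qed.

(** Eliminates bases: a coloop of the restriction to [F] is an element whose removal lowers the rank
    of [F]. *)
Lemma cyclic_flatP M F : cyclic_flat M F <->
  [/\ F \subset ground M,
      {in ground M :\: F, forall e, rank M F < rank M (e |: F)} &
      {in F, forall e, rank M (F :\ e) = rank M F}].
Proof.
split=> [[[FE flF] cyc]|[FE flF cyc]].
  split=> // e eF; apply/eqP; rewrite eqn_leq rank_mono ?subD1set //= leqNgt.
  by apply/negP => lt; apply: (cyc e); apply/coloop_restrP.
by split=> // e /(coloop_restrP _ FE)[/cyc ->]; rewrite ltnn.
Qed.

(** [F] is the closure of [C]. Removing an element of [C] keeps the rank because [C] is a circuit;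
    removing any other element leaves the spanning set [C] intact. *)
Lemma circuit_cyclic_flat M C : circuit M C ->
  exists F, [/\ cyclic_flat M F, C \subset F & rank M F < #|C|].
Proof.
move=> /minsetP[/andP[CE nC] minC].
have rC : rank M C < #|C| by rewrite ltn_neqAle rank_leq_card andbT (rank_leqif_card M C).
have rC1 e : e \in C -> rank M (C :\ e) = rank M C.
  move=> eC; apply/eqP; rewrite eqn_leq rank_mono ?subD1set //=.
  rewrite [X in _ <= X]rank_indep; first by rewrite (cardsD1 e) eC in rC.
  apply: contraT => nD; have /setP/(_ e) : C :\ e = C.
    by apply: minC; rewrite ?subD1set // /dependent nD (subset_trans _ CE) ?subD1set.
  by rewrite !inE eC eqxx.
pose F := [set e in ground M | rank M (e |: C) == rank M C].
have CF : C \subset F.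
  apply/subsetP => e eC; rewrite inE (subsetP CE) //= (setUidPr _) //.
  by rewrite sub1set.
have rF : rank M F = rank M C.
  rewrite -(setUidPl CF) rankU_absorb // => e.
  by rewrite inE => /andP[_ /eqP].
exists F; split; rewrite ?rF //; apply/cyclic_flatP; split.
- by apply/subsetP => e; rewrite inE => /andP[].
- move=> e; rewrite inE => /andP[nF eE]; rewrite rF.
  have lt : rank M C < rank M (e |: C).
    rewrite ltn_neqAle rank_mono ?subsetUr // andbT eq_sym.
    by move: nF; rewrite inE eE.
  by apply: leq_trans lt _; apply: rank_mono; apply: setUS.
- move=> e eF; apply/eqP; rewrite eqn_leq rank_mono ?subD1set //= rF.
  have [eC|eC] := boolP (e \in C).
    by rewrite -(rC1 e eC); apply: rank_mono; apply: setSD.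
  by apply: rank_mono; rewrite subsetD1 CF.
Qed.

(** A dependent set contains a circuit, and the closure of that circuit violates the bound. *)
Lemma indep_cyclic_flatP M I : I \in indep M <->
  I \subset ground M /\
  forall F, cyclic_flat M F -> #|I :&: F| <= rank M F.
Proof.
split=> [hI|[IE hF]].
  split=> [|F _]; first exact: indep_sub_ground.
  by apply: leq_card_rank (subsetIr _ _); apply: indepS hI (subsetIl _ _).
apply: contraT => nI; have depI : dependent M I by rewrite /dependent IE.
have [C cC CI] := minset_exists depI.
have [F [cF CF lt]] := circuit_cyclic_flat cC.
have := hF F cF; rewrite leqNgt (leq_trans lt) //.
by apply: subset_leq_card; rewrite subsetI CI.
Qed.

Lemma cyclic_flat_inj M N : ground M = ground N ->
  (forall F, cyclic_flat M F <-> cyclic_flat N F) ->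
  (forall F, cyclic_flat M F -> rank M F = rank N F) -> M = N.
Proof.
move=> eE eZ er; apply: matroid_eq => //; apply/setP => I.
apply/idP/idP => /indep_cyclic_flatP[IE hI]; apply/indep_cyclic_flatP.
  by rewrite -eE; split=> // F cF; have cF' := iffRL (eZ F) cF; rewrite -er ?hI.
by rewrite eE; split=> // F cF; rewrite er // hI //; apply/eZ.
Qed.

End Rank.

(** * The matroid union theorem *)

Section UnionRank.
Variables (U T : finType) (N : T -> matroid U).
Implicit Types (I X Y Z : {set U}) (L : U -> {set T}).

Definition rank_sum X := \sum_i rank (N i) X.

Lemma rank_sum_mono X Y : X \subset Y -> rank_sum X <= rank_sum Y.
Proof. by move=> XY; apply: leq_sum => i _; apply: rank_mono. Qed.

Lemma rank_sum_submod X Y :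
  rank_sum (X :|: Y) + rank_sum (X :&: Y) <= rank_sum X + rank_sum Y.
Proof. by rewrite -!big_split; apply: leq_sum => i _; apply: rank_submod. Qed.

Lemma union_indep_leq I : I \in union_indep N -> #|I| <= rank_sum I.
Proof.
move=> /union_indepP[J hJ ->].
apply: leq_trans (_ : \sum_i #|J i| <= _).
  elim/big_rec2: _ => [|i n X _ le]; first by rewrite cards0.
  by rewrite (leq_trans (leq_card_setU _ _)) ?leq_add2l.
by apply: leq_sum => i _; apply: leq_card_rank => //; apply: bigcup_sup.
Qed.

(** The set [L y] lists the matroids to which [y] may be assigned. Lists are introduced so that they
    can be shrunk one entry at a time. *)
Let hall L I := [forall Y : {set U}, (Y \subset I) ==>
  (#|Y| <= \sum_i rank (N i) [set y in Y | i \in L y])].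

(* Rado's argument: if [x] may go to both [a] and [b], then Hall's condition
   survives forbidding one of them, by submodularity.  Once every list is a
   singleton, the condition says that the colour classes are independent. *)
Lemma hall_union_indep L I : hall L I -> I \in union_indep N.
Proof.
have [n] := ubnP (\sum_(x in I) #|L x|).
elim: n L => // n IH L ltn hL; have hallL := elimT forall_inP hL.
have [/exists_inP[x xI /card_gt1P[a [b [ax bx ab]]]]|] :=
    boolP [exists x in I, 1 < #|L x|].
  pose L' c y := if y == x then L x :\ c else L y.
  have ltL' c : c \in L x -> \sum_(y in I) #|L' c y| < n.
    move=> cx; move: ltn; rewrite (bigD1 x) // [in X in _ -> X](bigD1 x) //=.
    rewrite /L' eqxx [#|L x|](cardsD1 c) cx.
    rewrite [X in _ -> _ + X < n](eq_bigr (fun y => #|L y|)) ?ltnS //.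
    by move=> y /andP[_ /negbTE ->].
  suff [/IH|/IH] : hall (L' a) I \/ hall (L' b) I by apply; apply: ltL'.
  apply/orP; apply: contraT; rewrite negb_or => /andP[].
  move=> /forall_inPn[Y1 YI1]; rewrite -ltnNge => lt1.
  have Y1I : Y1 \subset I := YI1.
  move=> /forall_inPn[Y2 YI2]; rewrite -ltnNge => lt2.
  have Y2I : Y2 \subset I := YI2.
  (* A set violating the condition for [L' c] contains [x], since elsewhere the lists are
     unchanged. *)
  have xY c Y : Y \subset I ->
      \sum_i rank (N i) [set y in Y | i \in L' c y] < #|Y| -> x \in Y.
    move=> YI; apply: contraLR => nx; rewrite -leqNgt.
    apply: leq_trans (hallL _ YI) _; apply: leq_sum => i _; apply: rank_mono.
    apply/subsetP => y; rewrite !inE /L' => /andP[yY iy].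
    by have [eyx|_] := eqVneq y x; [rewrite -eyx yY in nx|rewrite yY iy].
  have x1 := xY _ _ Y1I lt1; have x2 := xY _ _ Y2I lt2.
  (* Index by index, the two sets on the right have a union covering the part of [Y1 :|: Y2] allowed
     by [L]: as [a] and [b] differ, each index in [L x] survives for [x] on one side. The left side
     is [#|Y1| + #|Y2| - 1], while the two violations bound the right side by
     [#|Y1| + #|Y2| - 2]. *)
  have hU : #|Y1 :|: Y2| + #|(Y1 :&: Y2) :\ x| <=
      \sum_i rank (N i) [set y in Y1 | i \in L' a y] +
      \sum_i rank (N i) [set y in Y2 | i \in L' b y].
    apply: leq_trans (leq_add (hallL (Y1 :|: Y2) _) (hallL ((Y1 :&: Y2) :\ x) _)) _.
    - by rewrite subUset Y1I.
    - by rewrite (subset_trans (subD1set _ _)) // subIset // Y1I.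
    rewrite -!big_split; apply: leq_sum => i _.
    apply: leq_trans (rank_submod _ _ _); apply: leq_add; apply: rank_mono.
      apply/subsetP => y; rewrite !inE /L' => /andP[+ iy].
      have [eyx _|_ /orP[->|->]] := eqVneq y x; rewrite ?iy ?orbT //.
      rewrite eyx in iy *; rewrite x1 x2 !inE iy !andbT /=.
      by have [->|] := eqVneq i a.
    apply/subsetP => y; rewrite !inE /L' => /andP[/andP[/negbTE ->]].
    by move=> /andP[-> ->] ->.
  have := cardsUI Y1 Y2; rewrite (cardsD1 x (Y1 :&: Y2)) inE x1 x2.
  by move: hU lt1 lt2; lia.
rewrite negb_exists_in => /forall_inP L1.
pose J := [ffun i => [set y in I | i \in L y]].
have sumJ : \sum_i #|J i| <= #|I|.
  under eq_bigr => i _ do rewrite ffunE -sum1_card.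
  under eq_bigr => i _ do
    (under eq_bigl => y do rewrite inE; rewrite big_mkcondr /=).
  rewrite exchange_big -sum1_card; apply: leq_sum => y yI.
  by rewrite -big_mkcond sum1_card leqNgt L1.
apply/union_indepP; exists J; last first.
  apply/setP => x; apply/idP/bigcupP => [xI|[i _]]; last first.
    by rewrite ffunE inE => /andP[].
  have := hallL [set x]; rewrite sub1set cards1 => /(_ xI).
  have [L0|[i ix _]] := set_0Vmem (L x).
    rewrite big1 // => i _; apply/eqP; rewrite -leqn0.
    apply: leq_trans (rank_leq_card _ _) _; rewrite leqn0 cards_eq0 -subset0.
    by apply/subsetP => y; rewrite !inE => /andP[/eqP ->]; rewrite L0 inE.
  by exists i => //; rewrite ffunE inE xI.
(* The ranks of the classes sum to at least [#|I|] and their sizes to at most [#|I|], so rank equals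
   size in every class. *)
have := leqif_sum (fun i (_ : true) => rank_leqif_card (N i) (J i)).
case=> _ eqJ; suff : [forall (i | true), J i \in indep (N i)].
  by move=> /forall_inP h i; apply: h.
rewrite -eqJ eqn_leq; apply/andP; split.
  by apply: leq_sum => i _; apply: rank_leq_card.
apply: leq_trans sumJ _; apply: leq_trans (hallL I (subxx _)) _.
by apply: leq_sum => i _; rewrite ffunE.
Qed.

Lemma union_indepE I :
  (I \in union_indep N) =
  [forall Y : {set U}, (Y \subset I) ==> (#|Y| <= rank_sum Y)].
Proof.
apply/idP/forall_inP => [hI Y YI|h].
  exact: union_indep_leq (indepS (M := matroid_union N) hI YI).
apply: (@hall_union_indep (fun=> setT)); apply/forall_inP => Y YI.
apply: leq_trans (h Y YI) _; apply: leq_sum => i _; apply: rank_mono.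
by apply/subsetP => y yY; rewrite !inE yY.
Qed.

Lemma union_rank_leq X Y :
  rank (matroid_union N) X <= rank_sum Y + #|X :\: Y|.
Proof.
have [I [hI IX <-]] := rank_witness (matroid_union N) X.
rewrite -(cardsID Y I); apply: leq_add; last by rewrite subset_leq_card ?setSD.
apply: leq_trans (union_indep_leq _) (rank_sum_mono (subsetIr I Y)).
exact: (indepS (M := matroid_union N)) hI (subsetIl _ _).
Qed.

Lemma union_rank_witness X : exists2 Y : {set U}, Y \subset X &
  rank_sum Y + #|X :\: Y| <= rank (matroid_union N) X.
Proof.
have [I [hI IX cI]] := rank_witness (matroid_union N) X.
have condI (Y : {set U}) : Y \subset I -> #|Y| <= rank_sum Y.
  by move: hI; rewrite /= union_indepE => /forall_inP/(_ Y).
(* Tight subsets of [I] spanning the elements of [X :\: I] can be merged. *)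
have tight (W : {set U}) : W \subset X :\: I ->
    exists2 Y : {set U}, Y \subset I & rank_sum (W :|: Y) <= #|Y|.
  elim/set_ind: W => [_|x W xW IH].
    exists set0; rewrite ?sub0set // setU0 cards0 leqn0 sum_nat_eq0.
    by apply/forallP => i; rewrite -leqn0 -[0](@cards0 U) rank_leq_card.
  rewrite subUset sub1set inE => /andP[/andP[xI xX] /IH[Y1 Y1I h1]].
  (* Since [I] is maximum in [X], adding [x] produces a violating set [Z]. It contains [x], because
     subsets of [I] satisfy the condition. *)
  have : x |: I \notin union_indep N.
    apply/negP => hxI; have := leq_card_rank (M := matroid_union N) hxI.
    move=> /(_ X); rewrite subUset sub1set xX IX => /(_ isT).
    by rewrite -cI cardsU1 xI; lia.
  rewrite union_indepE => /forall_inPn[Z ZxI]; rewrite -ltnNge => ltZ.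
  have ZI : Z \subset x |: I := ZxI.
  have xZ : x \in Z.
    apply: contraLR ltZ => xZ; rewrite -leqNgt condI //.
    apply/subsetP => y yZ; have := subsetP ZI _ yZ.
    by rewrite !inE => /orP[/eqP eyx|//]; rewrite eyx (negbTE xZ) in yZ.
  have Y2I : Z :\ x \subset I.
    apply/subsetP => y; rewrite !inE => /andP[yx /(subsetP ZI)].
    by rewrite !inE (negbTE yx).
  exists (Y1 :|: Z :\ x); first by rewrite subUset Y1I.
  (* The intersection term is at least [#|Y1 :&: (Z :\ x)|], as that set lies in [I];
     inclusion-exclusion then makes the merged set tight. *)
  have := rank_sum_submod (W :|: Y1) Z.
  have -> : W :|: Y1 :|: Z = x |: W :|: (Y1 :|: Z :\ x).
    by rewrite -[in LHS](setD1K xZ) !setUA [_ :|: [set x]]setUC !setUA.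
  have leI : #|Y1 :&: (Z :\ x)| <= rank_sum ((W :|: Y1) :&: Z).
    apply: leq_trans (condI _ _) _; first by rewrite subIset ?Y1I.
    by apply: rank_sum_mono; apply: setISS; rewrite ?subsetUr ?subD1set.
  have := cardsUI Y1 (Z :\ x); rewrite (cardsD1 x) xZ in ltZ.
  by move: h1; lia.
have [Y YI hY] := tight _ (subxx _).
exists (X :\: I :|: Y).
  by rewrite subUset subsetDl (subset_trans YI).
have -> : X :\: (X :\: I :|: Y) = I :\: Y.
  apply/setP => y; rewrite !inE; have := subsetP IX y.
  by case: (y \in Y); case: (y \in I); case: (y \in X) => // /(_ isT).
by rewrite -cI -(cardsID Y I) (setIidPr YI) leq_add2r.
Qed.

End UnionRank.

(** * Blow-ups, parallel extensions and transfer of cyclic flats *)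

Section ParallelExtension.
Variables (U : finType) (t : nat) (E : {set U}) (S : U -> {set U}).
Hypothesis S_sets : expansion_sets t E S.
Implicit Types (A B X Y : {set U}) (M N : matroid U).

Definition trace X := [set e in E | ~~ [disjoint S e & X]].

Lemma traceP X e :
  reflect (e \in E /\ exists2 x, x \in S e & x \in X) (e \in trace X).
Proof.
rewrite inE; apply: (iffP andP) => [[eE /pred0Pn[x /andP[xe xX]]]|[eE [x xe xX]]].
  by split=> //; exists x.
by split=> //; apply/pred0Pn; exists x; apply/andP.
Qed.

Lemma trace_sub X : trace X \subset E.
Proof. by apply/subsetP => e /traceP[]. Qed.

Lemma mem_blow_up A e x : A \subset E -> e \in E -> x \in S e ->
  (x \in blow_up S A) = (e \in A).
Proof.
case: S_sets => _ _ dis /subsetP AE eE xe; apply/bigcupP/idP => [[f fA xf]|eA].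
  suff -> : e = f by [].
  apply/eqP; apply: contraT => ef.
  by have /pred0P/(_ x) := dis _ _ eE (AE _ fA) ef; rewrite /= xe xf.
by exists e.
Qed.

Lemma blow_upS A B : A \subset B -> blow_up S A \subset blow_up S B.
Proof.
move=> /subsetP AB; apply/subsetP => x /bigcupP[e eA xe].
by apply/bigcupP; exists e; rewrite ?AB.
Qed.

Lemma sub_blow_up_trace X : X \subset blow_up S E -> X \subset blow_up S (trace X).
Proof.
move=> /subsetP XS; apply/subsetP => x xX; have /bigcupP[e eE xe] := XS _ xX.
by apply/bigcupP; exists e => //; apply/traceP; split=> //; exists x.
Qed.

Lemma trace_blow_up A : A \subset E -> trace (blow_up S A) = A.
Proof.
move=> AE; apply/setP => e; apply/traceP/idP => [[eE [x xe]]|eA].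
  by rewrite (mem_blow_up AE eE xe).
have eE := subsetP AE _ eA; split=> //; case: S_sets => eS _ _.
by exists e; rewrite ?(mem_blow_up AE eE) ?eS.
Qed.

Lemma blow_upD A B : A \subset E -> B \subset E ->
  blow_up S A :\: blow_up S B = blow_up S (A :\: B).
Proof.
move=> AE BE; have DE : A :\: B \subset E by rewrite (subset_trans (subsetDl _ _)).
apply/setP => x; rewrite inE.
have [/bigcupP[e eE xe]|nx] := boolP (x \in blow_up S E).
  by rewrite !(mem_blow_up _ eE xe) // inE.
have nin (C : {set U}) : C \subset E -> (x \in blow_up S C) = false.
  by move=> CE; apply: contraNF nx; apply: (subsetP (blow_upS CE)).
by rewrite !nin.
Qed.

Lemma card_blow_up A : A \subset E -> #|blow_up S A| = t * #|A|.
Proof.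
case: S_sets => _ cS _; elim/set_ind: A => [_|e A eA IH].
  by rewrite /blow_up big_set0 !cards0 muln0.
rewrite subUset sub1set => /andP[eE AE].
rewrite /blow_up bigcup_setU big_set1 -/(blow_up S A) cardsU1 eA mulnDr muln1.
rewrite cardsU IH // cS // disjoint_setI0 ?cards0 ?subn0 //.
apply/pred0P => x; apply/negbTE/andP => -[/= xe].
by rewrite (mem_blow_up AE eE xe) (negbTE eA).
Qed.

(** Says that [e] and [x] have the same closure: both are loops when [e] has rank 0; otherwise they
    form a circuit of size two, whose singletons have rank 1. *)
Lemma rank_parallel_pair M N e x : ground M = E -> is_parallel_extension S M N ->
  e \in E -> x \in S e ->
  rank N (e |: [set x]) = rank N [set x] /\
  rank N (e |: [set x]) = rank N [set e].
Proof.
move=> gM [_ rM par lp] eE xe; have [->|ex] := eqVneq e x; first by rewrite setUid.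
have xS : x \in S e :\ e by rewrite !inE eq_sym ex.
have re : rank N [set e] = rank M [set e].
  by rewrite -[in RHS]rM rank_restr // sub1set gM.
rewrite -gM in eE; have := rank_leq_card M [set e]; rewrite cards1 -re.
case r0 : (rank N [set e]) => [|[|//]] _; rewrite re in r0.
  have /minsetP[/andP[_ nx] _] := lp e x eE xS r0.
  have rx : rank N [set x] = 0.
    have := rank_leqif_card N [set x]; rewrite cards1 => -[]; rewrite (negbTE nx).
    by case: (rank N _) => [|[]].
  have := rank_submod N [set e] [set x]; rewrite rx re r0.
  by case: (rank N (e |: _)).
have /andP[_ /minsetP[/andP[exE nex] mex]] := par e x eE xS r0.
have lt : rank N (e |: [set x]) <= 1.
  have := rank_leqif_card N (e |: [set x]); rewrite cards2 ex => -[].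
  by rewrite (negbTE nex); case: (rank N _) => [|[|[]]].
have ge : 1 <= rank N (e |: [set x]) by rewrite -r0 -re rank_mono ?subsetUl.
have rx : rank N [set x] = 1.
  rewrite rank_indep ?cards1 //; apply: contraT => nx.
  have /setP/(_ e) : [set x] = [set e; x].
    apply: mex; last exact: subsetUr.
    by rewrite /dependent nx (subset_trans _ exE) ?subsetUr.
  by rewrite !inE eqxx (negbTE ex).
by rewrite rx; split; apply/eqP; rewrite eqn_leq lt ge.
Qed.

(** Each of [X] and [trace X] lies in the closure of the other, so both have the rank of their
    union. *)
Lemma rank_parallel_extension M N X : ground M = E ->
  is_parallel_extension S M N -> X \subset blow_up S E ->
  rank N X = rank M (trace X).
Proof.
move=> gM hN XS; have pair := rank_parallel_pair gM hN.
case: hN => _ rM _ _; rewrite -[in RHS]rM rank_restr ?gM ?trace_sub //.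
have hX : rank N (trace X :|: X) = rank N X.
  apply: rankU_absorb => e /traceP[eE [x xe xX]].
  apply: (@rankU1_absorb _ _ _ [set x]); rewrite ?sub1set //.
  by have [] := pair e x eE xe.
rewrite -hX setUC; apply: rankU_absorb => x xX.
have /bigcupP[e eT xe] := subsetP (sub_blow_up_trace XS) _ xX.
have eE := subsetP (trace_sub X) _ eT.
apply: (@rankU1_absorb _ _ _ [set e]); rewrite ?sub1set // setUC.
by have [] := pair e x eE xe.
Qed.

(* Both [M] and [N] are described by a min formula over the same set function
   [f]; the formulas differ by the factor [t] on blow-ups, and the integrality
   of the values on [E] turns defects smaller than [t] into zero. *)
Lemma is_expansion_of_rank_formula M N (f : {set U} -> nat) :
  ground M = E -> ground N = blow_up S E ->
  (forall A B, rank M A <= f B + #|A :\: B|) ->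
  (forall A, exists2 B : {set U}, B \subset A & f B + #|A :\: B| <= rank M A) ->
  (forall X B, B \subset E -> rank N X <= t * f B + #|X :\: blow_up S B|) ->
  (forall X, X \subset blow_up S E -> exists2 B : {set U}, B \subset E &
     t * f B + #|X :\: blow_up S B| <= rank N X) ->
  is_expansion t S M N.
Proof.
move=> gM gN Mle Mwit Nle Nwit; have [eS cS _] := S_sets.
have t_gt0 e : e \in E -> 0 < t.
  by move=> eE; rewrite -(cS e eE); apply/card_gt0P; exists e; apply: eS.
have cD A B : A \subset E -> B \subset E ->
    t * f B + #|blow_up S A :\: blow_up S B| = t * (f B + #|A :\: B|).
  move=> AE BE; rewrite blow_upD // card_blow_up ?mulnDr //.
  exact: subset_trans (subsetDl _ _) AE.
have rS A : A \subset E -> rank N (blow_up S A) = t * rank M A.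
  move=> AE; apply/eqP; rewrite eqn_leq; apply/andP; split.
    have [B BA hB] := Mwit A; have BE := subset_trans BA AE.
    by apply: leq_trans (Nle _ B BE) _; rewrite cD // leq_mul2l hB orbT.
  have [B BE hB] := Nwit _ (blow_upS AE).
  by apply: leq_trans hB; rewrite cD // leq_mul2l Mle orbT.
split=> [|X|A /cyclic_flatP[]]; rewrite ?gN ?gM //;
  last by move=> AE _ _; apply: rS.
split=> [/cyclic_flatP[]|[A /cyclic_flatP[]]]; rewrite ?gN ?gM.
  move=> XS flX cycX; have [B BE hB] := Nwit X XS.
  (* Deleting an element of [X] outside [blow_up S B] would lower the bound attained by [B], hence
     the rank, against cyclicity. *)
  have XB : X \subset blow_up S B.
    apply/subsetP => x xX; apply: contraT => nx.
    have := Nle (X :\ x) B BE; rewrite cycX //.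
    have -> : X :\ x :\: blow_up S B = (X :\: blow_up S B) :\ x.
      by rewrite !setDDl setUC.
    by move: hB; rewrite (cardsD1 x (X :\: _)) inE nx xX; lia.
  (* Adding elements of [blow_up S B] leaves the rank within [t * f B], so flatness forces them into
     [X]. *)
  have eX : X = blow_up S B.
    apply/eqP; rewrite eqEsubset XB; apply/subsetP => x xB; apply: contraT => nx.
    have := flX x; rewrite inE nx (subsetP (blow_upS BE)) // => /(_ isT).
    rewrite ltnNge (leq_trans _ (leq_trans (leq_addr _ _) hB)) //.
    have := Nle (x |: X) B BE; rewrite (_ : _ :\: _ = set0) ?cards0 ?addn0 //.
    by apply/eqP; rewrite setD_eq0 subUset sub1set xB.
  exists B => //; apply/cyclic_flatP; split; rewrite ?gM //.
    move=> e; rewrite inE => /andP[eB eE]; have ee := eS _ eE.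
    have eBE : e |: B \subset E by rewrite subUset sub1set eE.
    have := flX e; rewrite eX inE (mem_blow_up BE eE ee) eB.
    rewrite (mem_blow_up (subxx E) eE ee) => /(_ eE) lt.
    rewrite -(ltn_pmul2l (t_gt0 e eE)) -!rS //; apply: leq_trans lt _.
    apply: rank_mono; rewrite subUset blow_upS ?subsetUr // andbT sub1set.
    by rewrite (mem_blow_up eBE eE ee) setU11.
  move=> e eB; have eE := subsetP BE _ eB; have ee := eS _ eE.
  have DE : B :\ e \subset E by rewrite (subset_trans (subD1set _ _)).
  (* A drop at [e] in [M] costs at least [t] in [N], but the [t - 1] elements of [S e :\ e] can
     restore at most [t - 1]. *)
  apply/eqP; rewrite eqn_leq rank_mono ?subD1set //= leqNgt; apply/negP => lt.
  have := cycX e; rewrite eX (mem_blow_up BE eE ee) => /(_ eB); rewrite rS //.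
  have -> : blow_up S B :\ e = (S e :\ e) :|: blow_up S (B :\ e).
    rewrite -[in LHS](setD1K eB) /blow_up bigcup_setU big_set1 setDUl.
    congr setU; apply/setDidPl; rewrite disjoint_sym disjoints1.
    by rewrite -/(blow_up S _) (mem_blow_up DE eE ee) !inE eqxx.
  move=> h; have := rankUl_leq N (S e :\ e) (blow_up S (B :\ e)).
  have := cS e eE; rewrite (cardsD1 e) ee h rS // => ct.
  by move: lt; rewrite -(leq_pmul2l (t_gt0 e eE)) mulnS; lia.
move=> AE flA cycA ->; apply/cyclic_flatP; rewrite gN; split.
- exact: blow_upS.
- move=> x; rewrite inE => /andP[xA /bigcupP[e eE xe]].
  rewrite (mem_blow_up AE eE xe) in xA; rewrite ltnNge; apply/negP => le.
  have xAS : x |: blow_up S A \subset blow_up S E.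
    by rewrite subUset blow_upS // sub1set (mem_blow_up (subxx E) eE xe) eE.
  have [B BE hB] := Nwit _ xAS; have := leq_trans hB le; rewrite rS //.
  (* If [e] is in [B], the bound for [A] also bounds [e |: A], against flatness of [A]. Otherwise
     [x] itself adds 1 to the defect, and [rank M A] would exceed its own upper bound. *)
  have tA := t_gt0 e eE; have [eB|eB] := boolP (e \in B).
    rewrite setDUl (_ : [set x] :\: blow_up S B = set0); last first.
      by apply/eqP; rewrite setD_eq0 sub1set (mem_blow_up BE eE xe).
    rewrite set0U cD // leq_pmul2l // => leA.
    have := flA e; rewrite inE xA eE => /(_ isT); rewrite ltnNge.
    rewrite (leq_trans (Mle _ B)) // setDUl.
    by rewrite (_ : [set e] :\: B = set0) ?set0U //; apply/eqP; rewrite setD_eq0 sub1set.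
  have -> : (x |: blow_up S A) :\: blow_up S B = x |: (blow_up S A :\: blow_up S B).
    rewrite setDUl; congr setU; apply/setDidPl; rewrite disjoints1.
    by rewrite (mem_blow_up BE eE xe).
  rewrite cardsU1 inE (mem_blow_up AE eE xe) (negbTE xA) andbF addnCA cD //.
  by have := Mle A B; rewrite -(leq_pmul2l tA); lia.
- move=> x /bigcupP[e eA xe]; have eE := subsetP AE _ eA; have tA := t_gt0 e eE.
  apply/eqP; rewrite eqn_leq rank_mono ?subD1set //= leqNgt rS //; apply/negP => lt.
  have xAS : blow_up S A :\ x \subset blow_up S E.
    by rewrite (subset_trans (subD1set _ _)) ?blow_upS.
  have [B BE hB] := Nwit _ xAS; have := leq_ltn_trans hB lt.
  have -> : blow_up S A :\ x :\: blow_up S B = (blow_up S A :\: blow_up S B) :\ x.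
    by rewrite !setDDl setUC.
  have := cD _ _ AE BE; rewrite (cardsD1 x) inE.
  rewrite (mem_blow_up AE eE xe) (mem_blow_up BE eE xe) eA andbT.
  (* If [e] is in [B], removing [x] does not change the defect, contradicting the bound on
     [rank M A]. Otherwise it saves only 1, so by divisibility by [t] the set [B] is a minimiser for
     [A], and [A :\ e] would have smaller rank. *)
  have [eB|eB] := boolP (e \in B).
    by have := Mle A B; rewrite -(leq_pmul2l tA); lia.
  move=> eq1 lt1; have : t * (f B + #|A :\: B|) <= t * rank M A by lia.
  rewrite leq_pmul2l // => leA.
  have := Mle (A :\ e) B; rewrite cycA //.
  have -> : A :\ e :\: B = (A :\: B) :\ e by rewrite !setDDl setUC.
  by move: leA; rewrite (cardsD1 e (A :\: B)) inE eB eA; lia.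
Qed.

End ParallelExtension.

Theorem theorem3p11 (U : finType) (t k : nat) (k_gt0 : 0 < k)
  (Mi : 'I_k -> matroid U) (M : matroid U)
  (groundMi : forall i, ground (Mi i) = ground M)
  (defM : M = matroid_union Mi)
  (S : U -> {set U}) (S_sets : expansion_sets t (ground M) S)
  (Mij : 'I_k -> 'I_t -> matroid U)
  (defMij : forall i j, is_parallel_extension S (Mi i) (Mij i j))
  (Mt : matroid U) :
  is_expansion t S M Mt <->
  Mt = matroid_union (fun ij : 'I_k * 'I_t => Mij ij.1 ij.2).
Proof.
set E := ground M in groundMi S_sets.
set N := matroid_union _.
have rN (Y : {set U}) : Y \subset blow_up S E ->
    rank_sum (fun ij : 'I_k * 'I_t => Mij ij.1 ij.2) Y =
    t * rank_sum Mi (trace E S Y).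
  move=> YS; rewrite /rank_sum big_distrr /=.
  rewrite -(pair_bigA _ (fun i j => rank (Mij i j) Y)) /=; apply: eq_bigr => i _.
  under eq_bigr => j _ do
    rewrite (rank_parallel_extension (groundMi i) (defMij i j) YS).
  by rewrite sum_nat_const card_ord.
have expN : is_expansion t S M N.
  apply: (is_expansion_of_rank_formula S_sets (f := rank_sum Mi)) => //.
  - apply/setP => x; apply/bigcupP/idP => [[[i j] _]|xS] /=.
      by have [-> _ _ _] := defMij i j; rewrite groundMi.
    (* The point [x] witnesses [0 < t], so an index pair exists; for [t = 0] both ground sets are
       empty. *)
    have /bigcupP[e eE xe] := xS; have [_ cS _] := S_sets.
    have t_gt0 : 0 < t by rewrite -(cS e eE); apply/card_gt0P; exists x.
    exists (Ordinal k_gt0, Ordinal t_gt0) => //=.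
    by have [-> _ _ _] := defMij (Ordinal k_gt0) (Ordinal t_gt0); rewrite groundMi.
  - by move=> A B; rewrite defM union_rank_leq.
  - by move=> A; rewrite defM; apply: union_rank_witness.
  - move=> X B BE; apply: leq_trans (union_rank_leq _ _ (blow_up S B)) _.
    by rewrite rN ?blow_upS // (trace_blow_up S_sets).
  - move=> X XS; have [Y YX hY] := union_rank_witness (fun ij => Mij ij.1 ij.2) X.
    have YS := subset_trans YX XS.
    (* Passing from [Y] to the blow-up of its trace preserves the rank sum and can only shrink the
       part of [X] left outside. *)
    exists (trace E S Y); first exact: trace_sub.
    apply: leq_trans hY; rewrite rN // leq_add2l subset_leq_card // setDS //.
    exact: sub_blow_up_trace.
(* What remains is uniqueness: two expansions share ground set, cyclic flats and their ranks. *)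
split=> [[gMt ZMt rMt]|-> //]; case: expN => gN ZN rNt.
apply: cyclic_flat_inj => [|F|F /ZMt[A cA ->]]; first by rewrite gMt gN.
  by rewrite ZMt ZN.
by rewrite rMt // rNt.
Qed.
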